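(* Let $(L,\leqslant)$ be an infinite linearly ordered set, $n$ an arbitrary natural number, $S$ a semigroup and $\mathfrak{h}\colon\mathscr{OI}_n(L)\to S$ a non-annihilating homomorphism, where $\mathscr{OI}_n(L)$ is the semigroup of partial order isomorphisms of $L$ of rank at most $n$. Then the homomorphic image $(\mathscr{OI}_n(L))\mathfrak{h}$ is a semigroup with a tight ideal series.
   Context: Natural numbers are positive integers. A partial order isomorphism of a linearly ordered set $(L,\leqslant)$ is an injective partial map $\alpha\colon L\rightharpoonup L$ with domain $\operatorname{dom}\alpha$ and range $\operatorname{ran}\alpha$ such that for all $x_1,x_2\in\operatorname{dom}\alpha$, $x_1\leqslant x_2$ implies $(x_1)\alpha\leqslant(x_2)\alpha$ (the empty partial map $\boldsymbol{0}$ is allowed). Maps are written on the right and composed from left to right: $(x)(\alpha\beta)=((x)\alpha)\beta$, with $\operatorname{dom}(\alpha\beta)=\{y\in\operatorname{dom}\alpha : (y)\alpha\in\operatorname{dom}\beta\}$. For a natural number $n$, $\mathscr{OI}_n(L)$ is the semigroup, under this composition, of all partial order isomorphisms $\alpha$ of $L$ with $|\operatorname{dom}\alpha|\leq n$. A homomorphism is annihilating if it is constant (its image is a single element), and non-annihilating otherwise. An infinite subset $D$ of a semigroup $T$ is called $\omega$-unstable if $sB\cup Bs\nsubseteq D$ for every $s\in D$ and every infinite subset $B\subseteq D$. A semigroup $T$ has a tight ideal series if there are $m\in\mathbb{N}$ and (two-sided) ideals $J_0\subseteq J_1\subseteq\cdots\subseteq J_m=T$ of $T$ such that $J_0$ is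 a finite ideal of $T$ and $J_k\setminus J_{k-1}$ is an $\omega$-unstable subset of $T$ for every $k=1,\ldots,m$. *)

(* Defs.v *)
From HB Require Import structures.
From mathcomp Require Import all_boot all_order.
From mathcomp Require Import boolp classical_sets functions cardinality.

Set Implicit Arguments.
Unset Strict Implicit.
Unset Printing Implicit Defensive.

Import Order.TTheory.

Local Open Scope classical_set_scope.
Local Open Scope card_scope.
Local Open Scope group_scope.

(* Partial maps L -> L; [None] means "undefined". *)
Definition partial_map (L : choiceType) := L -> option L.

HB.instance Definition _ (L : choiceType) := Choice.on (partial_map L).

Section PartialMaps.
Variable L : choiceType.
Implicit Types a b c : partial_map L.

Definition pdom a : set L := [set x | isSome (a x)].

(* Maps act on the right: the product of [a] and [b] applies [a] first. *)
Definition partial_mul a b : partial_map L := pcomp b a.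

Lemma partial_mulA : associative partial_mul.
Proof.
by move=> a b c; apply/funext => x; rewrite /partial_mul /pcomp; case: (a x).
Qed.

HB.instance Definition _ := isSemigroup.Build (partial_map L) partial_mulA.

Definition pinjective a : Prop :=
  forall x1 x2 y, a x1 = Some y -> a x2 = Some y -> x1 = x2.

End PartialMaps.

Definition partial_order_iso (d : Order.disp_t) (L : orderType d)
    (a : partial_map L) : Prop :=
  pinjective a /\
  forall x1 x2 y1 y2, a x1 = Some y1 -> a x2 = Some y2 ->
    (x1 <= x2)%O -> (y1 <= y2)%O.

Definition OI_set (d : Order.disp_t) (L : orderType d) (n : nat) :
    set (partial_map L) :=
  [set a | partial_order_iso a /\ pdom a #<= `I_n].
Arguments OI_set {d} L n.

Lemma OI_set_mulg_closed (d : Order.disp_t) (L : orderType d) (n : nat) :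
  mulg_closed (fun a : partial_map L => a \in OI_set L n).
Proof.
move=> a b /set_mem [[ainj amon] acard] /set_mem [[binj bmon] bcard].
have ME x y : (a * b) x = Some y -> exists2 z, a x = Some z & b z = Some y.
  rewrite [(a * b) x]/(partial_mul a b x) /partial_mul /pcomp.
  by case: (a x) => // z bz; exists z.
apply/mem_set; split; first split.
- move=> x1 x2 y /ME [z1 a1 b1] /ME [z2 a2 b2].
  by apply: (ainj _ _ z1 a1); rewrite (binj _ _ _ b1 b2).
- move=> x1 x2 y1 y2 /ME [z1 a1 b1] /ME [z2 a2 b2] le12.
  exact: bmon b1 b2 (amon _ _ _ _ a1 a2 le12).
- apply: card_le_trans acard; apply: subset_card_le => x /=.
  rewrite /pdom /= [(a * b) x]/(partial_mul a b x) /partial_mul /pcomp.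
  by case: (a x).
Qed.

Definition OI (d : Order.disp_t) (L : orderType d) (n : nat) : Type :=
  set_type (OI_set L n).

HB.instance Definition _ (d : Order.disp_t) (L : orderType d) (n : nat) :=
  SubChoice.on (OI L n).
HB.instance Definition _ (d : Order.disp_t) (L : orderType d) (n : nat) :=
  SubChoice_isSubSemigroup.Build (partial_map L)
    (fun a => a \in OI_set L n) (OI L n) (@OI_set_mulg_closed d L n).

Lemma range_mulg_closed (T S : semigroupType) (h : {multiplicative T -> S}) :
  mulg_closed (fun y : S => y \in range h).
Proof.
move=> _ _ /set_mem [x _ <-] /set_mem [y _ <-].
by apply/mem_set; exists (x * y) => //; rewrite gmulfM.
Qed.

Definition hom_image (T S : semigroupType) (h : {multiplicative T -> S}) :
    Type := set_type (range h).

HB.instance Definition _ (T S : semigroupType) (h : {multiplicative T -> S}) :=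
  SubChoice.on (hom_image h).
HB.instance Definition _ (T S : semigroupType) (h : {multiplicative T -> S}) :=
  SubChoice_isSubSemigroup.Build S
    (fun y => y \in range h) (hom_image h) (@range_mulg_closed T S h).

Definition annihilating (T S : semigroupType) (h : {multiplicative T -> S}) :
    Prop := exists c : S, range h = [set c].

Section TightIdealSeries.
Variable T : semigroupType.
Implicit Types J D B : set T.

Definition ideal J : Prop :=
  J !=set0 /\ forall t x, J x -> J (t * x) /\ J (x * t).

Definition omega_unstable D : Prop :=
  infinite_set D /\
  forall s B, D s -> B `<=` D -> infinite_set B ->
    ~ ([set s * b | b in B] `|` [set b * s | b in B] `<=` D).

Definition has_tight_ideal_series : Prop :=
  exists (m : nat) (J : nat -> set T),
    [/\ (0 < m)%N,
        (forall k, (k <= m)%N -> ideal (J k)),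
        (forall k, (k < m)%N -> J k `<=` J k.+1),
        J m = [set: T]
      & finite_set (J 0) /\
        (forall k, (1 <= k <= m)%N -> omega_unstable (J k `\` J k.-1))].

End TightIdealSeries.

(* Main.v *)
Require Import Defs.
From HB Require Import structures.
From mathcomp Require Import all_boot all_order.
From mathcomp Require Import finmap.
From mathcomp Require Import boolp classical_sets functions cardinality.

Set Implicit Arguments.
Unset Strict Implicit.
Unset Printing Implicit Defensive.

Import Order.TTheory.

Local Open Scope classical_set_scope.
Local Open Scope card_scope.

(** A partial order isomorphism between finite subsets of a chain is determined
by its domain and its range, since two finite chains of the same size are
isomorphic in exactly one way; conversely every pair of finite subsets of the
same size at most [n] occurs ([OI_ext], [iso_ex]).  Consequently a product [a * b]
of two elements of rank [q] has rank [q] only if the range of [a] is the domain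
of [b] ([rank_mul_max]).

These two facts force the kernel of every homomorphism [h] to be a Rees
congruence ([rees_threshold]): there is [p] such that [h] is constant on the
ideal of elements of rank at most [p] and separates every element of rank above
[p] from all the others.  Indeed, suppose that [h a = h b] with [a <> b] and
[rank b <= rank a = k].  Then some element of rank [k] has the same image as one
of smaller rank, and because any element of rank at most [k] is a product
[x * a * y], every element of rank at most [k] has the image of an element of
rank at most [k - 1].  That bound can be lowered by one as long as it is positive
([collapse_step]), so all elements of rank at most [k] have the image of the empty
map.  The threshold is the largest [k] for which this happens, and it is below
[n] since [h] is not constant.

The images [J k] of the ideals of elements of rank at most [p + k], for
[0 <= k <= n - p], are then a tight ideal series: [J 0] is a single point, and
[J k] minus [J (k - 1)] is a faithful copy of the elements of rank exactly [p + k],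
of which there are infinitely many.  If [s] and an infinite subset [B] of that
layer violated instability, with [s] the image of [a], every element of [B] would
be the image of the map whose domain is the range of [a] and whose range is the
domain of [a], so that [B] would be a single point. *)

(** * Domain, range and rank of a partial order isomorphism *)

Section RankCalculus.
Variables (d : Order.disp_t) (L : orderType d) (n : nat).
Implicit Types (a b c : OI L n) (s t : seq L).

(** The domain of [a], listed in increasing order, so that equal domains are
equal sequences. *)
Definition support a : seq L :=
  sort <=%O (fset_set (pdom (\val a)) : seq L).

(** The range of [a]; it is again in increasing order because [a] is monotone. *)
Definition imag a : seq L := pmap (\val a) (support a).

Definition rank a : nat := size (support a).

Lemma valP_OI a : OI_set L n (\val a).
Proof. by apply: set_mem; exact: valP. Qed.

Lemma valM a b x : \val (a * b)%g x = obind (\val b) (\val a x).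
Proof. by []. Qed.

Lemma mem_support a x : (x \in support a) = \val a x.
Proof.
have [_ card_a] := valP_OI a.
have fin_a : finite_set (pdom (\val a)).
  by apply: (card_le_finite card_a); exact: finite_II.
rewrite mem_sort in_fset_set //.
by apply/idP/idP => [/set_mem//|ax]; apply/mem_set.
Qed.

Lemma support_sorted a : sorted <%O (support a).
Proof. by rewrite sort_lt_sorted fset_uniq. Qed.

Lemma support_uniq a : uniq (support a).
Proof. exact/lt_sorted_uniq/support_sorted. Qed.

Lemma rank_leq_n a : rank a <= n.
Proof.
have [_ card_a] := valP_OI a.
by rewrite /rank size_sort; exact: geq_card_fset_set card_a.
Qed.

Lemma mem_imag a y : (y \in imag a) <-> exists x, \val a x = Some y.
Proof.
rewrite mem_pmap; split => [/mapP[x _ ->]|[x ax]]; first by exists x.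
by apply/mapP; exists x; rewrite ?mem_support ax.
Qed.

Lemma size_imag a : size (imag a) = rank a.
Proof.
rewrite size_pmap; apply/eqP; rewrite -all_count.
by apply/allP => x; rewrite mem_support.
Qed.

Lemma imag_sorted a : sorted <%O (imag a).
Proof.
have [[a_inj a_mono] _] := valP_OI a.
rewrite /imag lt_sorted_pairwise.
have := support_sorted a; rewrite lt_sorted_pairwise.
elim: (support a) => //= x s IHs /andP[x_s /IHs{}IHs].
case ax: (\val a x) => [y|] //=; rewrite IHs andbT.
apply/allP => z; rewrite mem_pmap => /mapP[u u_s /esym au].
have /allP/(_ u u_s) := x_s => x_u.
rewrite lt_neqAle (a_mono _ _ _ _ ax au (ltW x_u)) andbT.
apply/eqP => yz; rewrite -yz in au.
by move: x_u; rewrite (a_inj _ _ _ ax au) ltxx.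
Qed.

Lemma imag_uniq a : uniq (imag a).
Proof. exact/lt_sorted_uniq/imag_sorted. Qed.

(** Two increasing injections with the same domain and the same range agree,
since both match the elements of the two finite chains in order. *)
Lemma OI_ext a b : support a = support b -> imag a = imag b -> a = b.
Proof.
move=> eq_s eq_i; apply: val_inj; apply/funext => x.
have := mem_support a x; have := mem_support b x; rewrite -eq_s.
case xs: (x \in support a); last by case: (\val a x); case: (\val b x).
move=> _ _; move: eq_i; rewrite /imag -eq_s => eq_i.
have : {in support a, forall x, \val b x}.
  by move=> u; rewrite eq_s mem_support.
have : {in support a, forall x, \val a x} by move=> u; rewrite mem_support.
elim: (support a) xs eq_i => //= u s IHs.
rewrite in_cons => x_us eq_i da db.
have := da u (mem_head _ _); have := db u (mem_head _ _).
move: eq_i x_us.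
case au: (\val a u) => [y|//]; case bu: (\val b u) => [z|//] /= [yz eq_i].
case/orP => [/eqP->|x_s _ _]; first by rewrite au bu yz.
by apply: IHs => // v vs; [apply: da | apply: db]; rewrite in_cons vs orbT.
Qed.

(** Sends the [i]-th entry of [s] to the [i]-th entry of [t]; the default of
[nth] is never reached when the sizes agree. *)
Definition iso_map s t : partial_map L :=
  fun x => if x \in s then Some (nth x t (index x s)) else None.

Lemma iso_ex s t :
    sorted <%O s -> sorted <%O t -> size s = size t -> size s <= n ->
  exists a, [/\ \val a = iso_map s t, support a = s & imag a = t].
Proof.
move=> s_sorted t_sorted eq_st s_n.
have nth_t x y : x \in s -> y \in s ->
    (nth x t (index x s) <= nth y t (index y s))%O = (x <= y)%O.
  move=> xs ys.
  rewrite (set_nth_default x y) -?eq_st ?index_mem //.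
  rewrite lt_sorted_leq_nth ?inE -?eq_st ?index_mem //.
  rewrite -[X in (X <= y)%O](nth_index x xs) -[X in (_ <= X)%O](nth_index x ys).
  by rewrite lt_sorted_leq_nth ?inE ?index_mem.
have st_OI : iso_map s t \in OI_set L n.
  apply/mem_set; split; first split.
  - move=> x1 x2 y; rewrite /iso_map.
    case: ifP => // x1s [<-]; case: ifP => // x2s [] eq12.
    by apply: le_anti; rewrite -(nth_t x1 x2) // -(nth_t x2 x1) // eq12 lexx.
  - move=> x1 x2 y1 y2; rewrite /iso_map.
    by case: ifP => // x1s [<-]; case: ifP => // x2s [<-]; rewrite nth_t.
  - have -> : pdom (iso_map s t) = [set` [fset x in s]%fset].
      by apply/seteqP; split=> x; rewrite /pdom /iso_map /= !inE; case: ifP.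
    have /card_eq_fsetP card_s : #|` [fset x in s]%fset| = size s.
      by rewrite card_fseq undup_id // lt_sorted_uniq.
    by rewrite (card_le_eql card_s) card_le_II.
pose a : OI L n := Sub (iso_map s t) st_OI.
have val_a : \val a = iso_map s t by rewrite SubK.
have supp_a : support a = s.
  apply: lt_sorted_eq => // [|x]; first exact: support_sorted.
  by rewrite mem_support val_a /iso_map; case: ifP.
exists a; split=> //.
apply: lt_sorted_eq => // [|y]; first exact: imag_sorted.
apply/idP/idP => [/mem_imag[x]|yt].
  rewrite val_a /iso_map; case: ifP => // xs [<-].
  by rewrite mem_nth // -eq_st index_mem.
have i_s : index y t < size s by rewrite eq_st index_mem.
apply/mem_imag; exists (nth y s (index y t)).
rewrite val_a /iso_map mem_nth // index_uniq // ?lt_sorted_uniq //.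
by rewrite (set_nth_default y) -?eq_st // nth_index.
Qed.

(** The witness is the partial identity on [s]. *)
Lemma restriction_ex a s : subseq s (support a) ->
  exists e, [/\ support e = s, imag e = s &
    forall b, support (e * b)%g = [seq x <- support b | x \in s]].
Proof.
move=> s_a; have s_sorted := subseq_lt_sorted s_a (support_sorted a).
have s_n : size s <= n := leq_trans (size_subseq s_a) (rank_leq_n a).
have [e [val_e supp_e imag_e]] := iso_ex s_sorted s_sorted erefl s_n.
exists e; split=> // b; apply: lt_sorted_eq => [||x].
- exact: support_sorted.
- exact/lt_sorted_filter/support_sorted.
rewrite mem_filter !mem_support valM val_e /iso_map.
by case: ifP => //= xs; rewrite nth_index.
Qed.

(** * Products and rank *)

Lemma sub_support_mull a b : {subset support (a * b)%g <= support a}.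
Proof. by move=> x; rewrite !mem_support valM; case: (\val a x). Qed.

Lemma sub_imag_mulr a b : {subset imag (a * b)%g <= imag b}.
Proof.
move=> y /mem_imag[x]; rewrite valM; case: (\val a x) => //= z bz.
by apply/mem_imag; exists z.
Qed.

Lemma rank_mull a b : rank (a * b)%g <= rank a.
Proof. exact: uniq_leq_size (support_uniq _) (@sub_support_mull a b). Qed.

Lemma rank_mulr a b : rank (a * b)%g <= rank b.
Proof.
rewrite -!size_imag; exact: uniq_leq_size (imag_uniq _) (@sub_imag_mulr a b).
Qed.

Lemma support_mul a b :
  {subset imag a <= support b} -> support (a * b)%g = support a.
Proof.
move=> ab; apply: lt_sorted_eq; try exact: support_sorted.
move=> x; rewrite !mem_support valM; case ax: (\val a x) => [y|] //=.
by rewrite -mem_support ab //; apply/mem_imag; exists x.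
Qed.

Lemma imag_mul a b :
  {subset imag a <= support b} -> imag (a * b)%g = pmap (\val b) (imag a).
Proof.
move=> ab; rewrite {1}/imag support_mul // (eq_pmap (valM a b)) /imag.
by elim: (support a) => //= x s IHs; case: (sval a x) => [y|] //=; rewrite IHs.
Qed.

(** The domain of [a * b] lies in that of [a], so equality of ranks makes [a * b]
defined wherever [a] is; then the range of [a] lies in the domain of [b], and the
two have the same size. *)
Lemma rank_mul_max a b :
  rank a = rank b -> rank (a * b)%g = rank a -> imag a = support b.
Proof.
move=> eq_ab eq_a.
have [|_ supp_ab] :=
    uniq_min_size (support_uniq (a * b)%g) (@sub_support_mull a b).
  by rewrite -/(rank _) -/(rank _) eq_a.
have ab : {subset imag a <= support b}.
  move=> y /mem_imag[x ax]; have := supp_ab x.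
  by rewrite !mem_support valM ax.
have [|_ eq_i] := uniq_min_size (imag_uniq a) ab.
  by rewrite size_imag eq_ab.
apply: lt_sorted_eq => //; [exact: imag_sorted | exact: support_sorted].
Qed.

(** Take as middle part the restriction of [a] to the first [rank c] points of its
domain: [x] carries the domain of [c] onto these points, and [y] carries their
images onto the range of [c]. *)
Lemma factor_through a c :
  rank c <= rank a -> exists x y : OI L n, c = (x * a * y)%g.
Proof.
move=> c_a.
pose s := take (rank c) (support a); pose t := take (rank c) (imag a).
have s_size : size s = rank c by rewrite size_takel.
have t_size : size t = rank c by rewrite size_takel ?size_imag.
have s_sorted : sorted <%O s.
  exact: subseq_lt_sorted (take_subseq _ _) (support_sorted a).
have t_sorted : sorted <%O t.
  exact: subseq_lt_sorted (take_subseq _ _) (imag_sorted a).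
have [|x [_ supp_x imag_x]] := iso_ex (support_sorted c) s_sorted (esym s_size).
  exact: rank_leq_n.
have [||y [_ supp_y imag_y]] := iso_ex t_sorted (imag_sorted c).
- by rewrite t_size size_imag.
- by rewrite t_size rank_leq_n.
have xa : {subset imag x <= support a} by rewrite imag_x => z /mem_take.
have imag_xa : imag (x * a)%g = t.
  rewrite imag_mul // imag_x /t /imag.
  rewrite -[in RHS](cat_take_drop (rank c) (support a)).
  rewrite pmap_cat take_size_cat // size_pmap -[RHS]s_size; apply/eqP.
  by rewrite -all_count; apply/allP => z /mem_take; rewrite mem_support.
have xay : {subset imag (x * a)%g <= support y} by rewrite imag_xa supp_y.
exists x, y; apply: OI_ext; first by rewrite !support_mul.
by rewrite imag_mul // imag_xa -imag_y /imag supp_y.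
Qed.

Lemma left_unit_ex a :
  exists e : OI L n,
    [/\ support e = support a, imag e = support a & (e * a)%g = a].
Proof.
have [e [supp_e imag_e _]] := restriction_ex (subseq_refl (support a)).
have ea : {subset imag e <= support a} by rewrite imag_e.
exists e; split=> //; apply: OI_ext; first by rewrite support_mul.
by rewrite imag_mul // imag_e.
Qed.

Lemma right_unit_ex a :
  exists e : OI L n, support e = imag a /\ (a * e)%g = a.
Proof.
have [|e [_ supp_e imag_e]] :=
    iso_ex (imag_sorted a) (imag_sorted a) erefl.
  by rewrite size_imag rank_leq_n.
have ae : {subset imag a <= support e} by rewrite supp_e.
exists e; split=> //; apply: OI_ext; first by rewrite support_mul.
by rewrite imag_mul // -{1}supp_e -/(imag e).
Qed.

Lemma rank0_ex : exists a, rank a = 0.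
Proof.
have [a [_ supp_a _]] :=
  iso_ex (s := [::]) (t := [::]) isT isT erefl (leq0n n).
by exists a; rewrite /rank supp_a.
Qed.

Lemma rank0_uniq a b : rank a = 0 -> rank b = 0 -> a = b.
Proof.
by move=> /size0nil a0 /size0nil b0; apply: OI_ext; rewrite /imag a0 b0.
Qed.

(** Finitely many elements of rank [q] would have domains covering only a finite
part of [L], and [q] points outside it are the domain of one more. *)
Lemma infinite_level (q : nat) :
  infinite_set [set: L] -> 0 < q <= n ->
  infinite_set [set c : OI L n | rank c = q].
Proof.
move=> L_inf /andP[q_gt0 q_n] fin_q.
pose F := \bigcup_(c in [set c : OI L n | rank c = q]) [set` support c].
have fin_F : finite_set F by apply: bigcup_finite => // c _; exact: finite_seq.
have [X XF q_X] := infinite_set_fset q (infinite_setD L_inf fin_F).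
pose s := take q (sort <=%O (X : seq L)).
have s_size : size s = q by rewrite size_takel // size_sort.
have s_sorted : sorted <%O s.
  apply: subseq_lt_sorted (take_subseq _ _) _.
  by rewrite sort_lt_sorted fset_uniq.
have [|c [_ supp_c _]] := iso_ex s_sorted s_sorted erefl.
  by rewrite s_size.
case s_eq: s => [|x s']; first by rewrite -s_size s_eq in q_gt0.
have xs : x \in s by rewrite s_eq mem_head.
have /XF[_] : [set` X] x by have := mem_take xs; rewrite mem_sort.
by apply; exists c; rewrite /= ?/rank supp_c.
Qed.

End RankCalculus.

(** * Kernels of homomorphisms are Rees congruences *)

Section Collapse.
Variables (d : Order.disp_t) (L : orderType d) (n : nat) (S : semigroupType).
Variable h : {multiplicative OI L n -> S}.
Implicit Types a b c : OI L n.

(** For [r = 0] this says that [h] is constant on the elements of rank at most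
[k], because the empty map is the only element of rank 0; larger [r] are the
stages from which that is reached. *)
Definition collapses (k r : nat) : Prop :=
  forall c, rank c <= k -> exists2 b, rank b <= r & h c = h b.

(** Writing [c = x * a * y], the image of [c] is also that of [x * b * y], whose rank
does not exceed that of [b]. *)
Lemma collapse_spread a b r :
  h a = h b -> rank b <= r -> collapses (rank a) r.
Proof.
move=> h_ab b_r c /factor_through[x [y ->]].
exists (x * b * y)%g; last by rewrite !gmulfM h_ab.
exact: leq_trans (rank_mull _ _) (leq_trans (rank_mulr _ _) b_r).
Qed.

(** After restricting to the domain of [a], there is [b] with [h a = h b], rank at
most [r + 1] and domain inside that of [a].  Deleting a point [x] of the domain
of [b] from both maps gives an element of rank [rank a - 1] identified with one of
rank at most [r], so all elements of rank at most [rank a - 1] are identified with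
elements of rank at most [r].  As [r + 1 < rank a], this applies to [b]
itself, hence to [a]. *)
Lemma collapse_step a r :
  r.+1 < rank a -> collapses (rank a) r.+1 -> collapses (rank a) r.
Proof.
move=> r_a /(_ a (leqnn _)) [b0 b0_r h_ab0].
have [e [supp_e _ ea]] := left_unit_ex a.
pose b := (e * b0)%g.
have h_ab : h a = h b by rewrite -[in LHS]ea !gmulfM h_ab0.
have b_r : rank b <= r.+1 := leq_trans (rank_mulr _ _) b0_r.
have [/(collapse_spread h_ab)//|r_b] := leqP (rank b) r.
have [x xb] : exists x, x \in support b.
  move: r_b; rewrite /rank; case: (support b) => // x s _.
  by exists x; rewrite mem_head.
have xa : x \in support a by rewrite -supp_e (sub_support_mull xb).
(* f is the identity on the domain of a with x deleted. *)
have [f [supp_f imag_f f_mul]] := restriction_ex (rem_subseq x (support a)).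
have fa_rank : rank (f * a)%g = (rank a).-1.
  rewrite /rank support_mul ?supp_f ?size_rem // imag_f.
  exact: mem_rem.
have fb_rank : rank (f * b)%g <= r.
  rewrite -ltnS; apply: leq_trans b_r.
  apply: (@uniq_leq_size _ (x :: support (f * b)%g)).
    rewrite /= support_uniq andbT f_mul mem_filter mem_rem_uniq ?support_uniq //.
    by rewrite inE eqxx.
  move=> y; rewrite in_cons => /predU1P[->//|].
  by rewrite f_mul mem_filter => /andP[].
have h_fab : h (f * a)%g = h (f * b)%g by rewrite gmulfM h_ab -gmulfM.
have b_fa : rank b <= rank (f * a)%g.
  rewrite fa_rank -ltnS prednK; first exact: leq_ltn_trans b_r r_a.
  exact: ltn_trans r_a.
have [c c_r h_bc] := collapse_spread h_fab fb_rank b_fa.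
exact: collapse_spread (etrans h_ab h_bc) c_r.
Qed.

Lemma collapse_to_zero a r :
  r < rank a -> collapses (rank a) r -> collapses (rank a) 0.
Proof.
elim: r => // r IHr r_a /(collapse_step r_a); exact: IHr (ltnW r_a).
Qed.

(** It suffices to identify [a] with an element of smaller rank.  If [b] has the
same rank as [a], let [e] and [f] be the partial identities on the domain and the
range of [a].  Then [h a] is also the image of [e * b] and of [b * f]; the former
has smaller rank unless [b] has the domain of [a], the latter unless [b] has the
range of [a], and [a <> b] excludes both at once. *)
Lemma collision_collapses a b :
  h a = h b -> rank b <= rank a -> a <> b -> collapses (rank a) 0.
Proof.
move=> h_ab b_a neq_ab.
suff [c c_a h_ac] : exists2 c, rank c < rank a & h a = h c.
  have c_a' : rank c <= (rank a).-1.
    by rewrite -ltnS prednK ?(leq_ltn_trans _ c_a).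
  apply: collapse_to_zero (collapse_spread h_ac c_a').
  by rewrite prednK ?(leq_ltn_trans _ c_a).
have [b_lt|a_b] := ltnP (rank b) (rank a); first by exists b.
have eq_rank : rank a = rank b by apply/eqP; rewrite eqn_leq a_b.
have [e [supp_e imag_e ea]] := left_unit_ex a.
have [f [supp_f af]] := right_unit_ex a.
have [eb_lt|eb_ge] := ltnP (rank (e * b)%g) (rank a).
  by exists (e * b)%g => //; rewrite -[in LHS]ea !gmulfM h_ab.
have [bf_lt|bf_ge] := ltnP (rank (b * f)%g) (rank a).
  by exists (b * f)%g => //; rewrite -[in LHS]af !gmulfM h_ab.
have e_rank : rank e = rank a by rewrite /rank supp_e.
have f_rank : rank f = rank a by rewrite /rank supp_f size_imag.
case: neq_ab; apply: OI_ext.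
  rewrite -imag_e; apply: rank_mul_max; first by rewrite e_rank.
  by apply/eqP; rewrite eqn_leq (rank_mull _ _) e_rank.
rewrite -supp_f; apply/esym/rank_mul_max; first by rewrite f_rank.
by apply/eqP; rewrite eqn_leq (rank_mull _ _) -eq_rank.
Qed.

(** The kernel of [h] is the Rees congruence of the ideal of elements of rank at
most [p]; this [p] is the largest rank up to which [h] identifies everything with
the empty map. *)
Lemma rees_threshold : ~ annihilating h ->
  exists p, [/\ p < n,
    (forall a b, rank a <= p -> rank b <= p -> h a = h b) &
    (forall a b, p < rank a -> h a = h b -> a = b)].
Proof.
move=> h_na.
have collapses_eq p a b :
    collapses p 0 -> rank a <= p -> rank b <= p -> h a = h b.
  move=> p0 /p0[a0 a0_0 ->] /p0[b0 b0_0 ->].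
  by congr (h _); apply: rank0_uniq; apply/eqP; rewrite -leqn0.
have collapses_lt p : collapses p 0 -> p < n.
  move=> p0; rewrite ltnNge; apply/negP => n_p; apply: h_na.
  have [z _] := rank0_ex L n.
  exists (h z); apply/seteqP; split=> [_ [a _ <-]|_ ->]; last by exists z.
  by apply: (collapses_eq p) => //; exact: leq_trans (rank_leq_n _) n_p.
have ex_p : exists p, `[< collapses p 0 >].
  by exists 0; apply/asboolP => c c0; exists c.
have bound_p p : `[< collapses p 0 >] -> p <= n.
  by move=> /asboolP/collapses_lt/ltnW.
have [p /asboolP p0 p_max] := ex_maxnP ex_p bound_p.
exists p; split; [exact: collapses_lt | by move=> a b; exact: collapses_eq|].
move=> a b p_a h_ab; apply: contrapT => neq_ab.
wlog a_b : a b p_a h_ab neq_ab / rank b <= rank a.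
  move=> H; have [/(H _ _ p_a h_ab neq_ab)//|/ltnW a_b] := leqP (rank b) (rank a).
  by apply: (H b a) => //; [exact: leq_trans p_a a_b | exact: nesym].
have /asboolP/p_max := collision_collapses h_ab a_b neq_ab.
by rewrite leqNgt p_a.
Qed.

End Collapse.

(** * The tight ideal series *)

Theorem mainTheorem5 (d : Order.disp_t) (L : orderType d) (n : nat)
    (S : semigroupType) (h : {multiplicative OI L n -> S})
    (Linf : infinite_set [set: L]) (n_gt0 : (0 < n)%N)
    (hna : ~ annihilating h) :
  has_tight_ideal_series (hom_image h).
Proof.
have [p [p_n h_const h_inj]] := rees_threshold hna.
pose J k : set (hom_image h) :=
  [set y | exists2 c, rank c <= p + k & \val y = h c].
have imageP (y : hom_image h) : exists c, \val y = h c.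
  by have /set_mem[c _ <-] := valP y; exists c.
have liftP c : exists y : hom_image h, \val y = h c.
  have hc : h c \in range h by apply/mem_set; exists c.
  by exists (Sub (h c) hc); rewrite SubK.
have [z z0] := rank0_ex L n.
(* The k-th layer is exactly the image of the elements of rank p + k. *)
have levelP k y : 0 < k -> (J k `\` J k.-1) y ->
    exists2 c, rank c = p + k & \val y = h c.
  case: k => // k _ [[c c_k yc] yNk]; exists c => //.
  apply/eqP; rewrite eqn_leq c_k addnS ltnNge; apply/negP => c_k'.
  by apply: yNk; exists c.
have level_mem k (y : hom_image h) c : 0 < k -> rank c = p + k -> \val y = h c ->
    (J k `\` J k.-1) y.
  case: k => // k _ c_k yc; split=> [|[b b_k yb]]; first by exists c; rewrite ?c_k.
  have c_b : c = b by apply: h_inj; rewrite ?c_k ?addnS ?ltnS ?leq_addr -?yc.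
  by move: b_k; rewrite -c_b c_k addnS ltnn.
exists (n - p), J; split.
- by rewrite subn_gt0.
- move=> k _; split.
    by have [y yz] := liftP z; exists y, z; rewrite // z0.
  move=> t x [c c_k xc]; have [b tb] := imageP t.
  split; [exists (b * c)%g | exists (c * b)%g].
  + exact: leq_trans (rank_mulr _ _) c_k.
  + by rewrite [RHS]gmulfM -xc -tb.
  + exact: leq_trans (rank_mull _ _) c_k.
  + by rewrite [RHS]gmulfM -xc -tb.
- move=> k _ y [c c_k yc]; exists c => //.
  by rewrite addnS (leq_trans c_k).
- apply/seteqP; split=> // y _; have [c yc] := imageP y.
  by exists c; rewrite // subnKC ?rank_leq_n // ltnW.
- split.
    have [y0 y0z] := liftP z.
    apply: (@sub_finite_set _ _ [set y0]) => // y [c c_p yc].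
    apply: val_inj; rewrite yc y0z.
    by apply: h_const; [rewrite -(addn0 p) | rewrite z0].
  move=> k /andP[k_gt0 k_m].
  have pk_n : p + k <= n by rewrite -leq_subRL // ltnW.
  have p_pk : p < p + k by rewrite -addn1 leq_add2l.
  split.
    move=> fin_D; apply: (@infinite_level _ L n (p + k) Linf).
      by rewrite addn_gt0 k_gt0 orbT.
    have fin_valD := finite_image (fun y : hom_image h => \val y) fin_D.
    apply: sub_finite_set (finite_preimage (f := h) _ fin_valD) => [c c_k|c c'].
      have [y yc] := liftP c; exists y => //.
      exact: level_mem k_gt0 c_k yc.
    move=> /set_mem[y /(levelP _ _ k_gt0)[b b_k yb] yc] _; apply: (h_inj).
    by rewrite -(h_inj b c) ?b_k // -yb.
  (* Products with s that stay in the layer have the maximal rank, which pins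
     down the domain and the range of each element of B. *)
  move=> s B Ds B_D B_inf sB_D.
  have [a a_k sa] := levelP _ _ k_gt0 Ds.
  have B_char y : B y -> exists c,
      [/\ \val y = h c, support c = imag a & imag c = support a].
    move=> By; have [c c_k yc] := levelP _ _ k_gt0 (B_D _ By).
    have max_rank b1 b2 (y1 y2 : hom_image h) :
        \val y1 = h b1 -> \val y2 = h b2 -> rank b1 = p + k -> rank b2 = p + k ->
        (J k `\` J k.-1) (y1 * y2)%g -> imag b1 = support b2.
      move=> yb1 yb2 b1_k b2_k /(levelP _ _ k_gt0)[b b_k y_b].
      have h_b : h b = h (b1 * b2)%g by rewrite gmulfM -yb1 -yb2 -y_b.
      apply: rank_mul_max; first by rewrite b1_k.
      by rewrite -(h_inj b (b1 * b2)%g) ?b_k.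
    exists c; split=> //.
      by apply/esym; apply: (max_rank _ _ s y) => //; apply: sB_D; left; exists y.
    by apply: (max_rank _ _ y s) => //; apply: sB_D; right; exists y.
  have [y0 By0] := infinite_setN0 B_inf.
  apply: B_inf; apply: (@sub_finite_set _ _ [set y0]) => // y By /=.
  have [c [yc supp_c imag_c]] := B_char _ By.
  have [c0 [yc0 supp_c0 imag_c0]] := B_char _ By0.
  apply: val_inj; rewrite yc yc0; congr (h _).
  by apply: OI_ext; rewrite ?supp_c ?imag_c.
Qed.
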